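(* Let $d=3$. The ring $\Bbbk[\mathcal S]$ has depth two if and only if both of the following hold: (i) $\operatorname{Ap}(\mathcal S,\mathbf b)$ does not have a maximal element with respect to $\preceq_{\mathcal S}$ for some (equivalently, for all) $\mathbf b\in\mathcal S\setminus\{\mathbf 0\}$; and (ii) $\operatorname{Ap}(\mathcal S,\mathbf a_i)\cap\operatorname{Ap}(\mathcal S,\mathbf a_j)$ has a maximal element with respect to $\preceq_{\mathcal S}$ for some $1\le i<j\le 3$.
   Context: $\Bbbk$ is an arbitrary field. $\mathcal S$ is a simplicial affine semigroup, i.e. the submonoid of $\mathbb N^d$ generated by a finite minimal generating set $\mathcal A=\{\mathbf a_1,\dots,\mathbf a_e\}\subset\mathbb N^d$, where the subgroup $\mathbb Z\mathcal A\subseteq\mathbb Z^d$ has rank $d$ and $E=\{\mathbf a_1,\dots,\mathbf a_d\}$ is $\mathbb Q$-linearly independent and generates the rational cone $\operatorname{pos}(\mathcal A)=\{\sum_{i=1}^e q_i\mathbf a_i : q_i\in\mathbb Q_{\ge0}\}$; each $\mathbf a_i$ with $1\le i\le d$ is the componentwise smallest element of $\mathcal A$ lying on its extremal ray of $\operatorname{pos}(\mathcal A)$. Here $d=3$. $\Bbbk[\mathcal S]=\bigoplus_{\mathbf a\in\mathcal S}\Bbbk\,\mathbf t^{\mathbf a}\subseteq\Bbbk[t_1,\dots,t_d]$ is the semigroup ring, and its depth is the maximal length of a regular sequence on $\Bbbk[\mathcal S]$ contained in the monomial maximal ideal $\mathfrak m=(\mathbf t^{\mathbf a}:\mathbf a\in\mathcal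 S\setminus\{\mathbf 0\})$. For $\mathbf b\in\mathcal S$, $\operatorname{Ap}(\mathcal S,\mathbf b)=\{\mathbf a\in\mathcal S : \mathbf a-\mathbf b\notin\mathcal S\}$. The partial order $\preceq_{\mathcal S}$ on $\mathcal S$ is defined by $\mathbf a\preceq_{\mathcal S}\mathbf a'$ iff $\mathbf a'-\mathbf a\in\mathcal S$. *)

(* Defs.v *)
From HB Require Import structures.
From mathcomp Require Import all_boot all_order all_algebra.
From mathcomp Require Import boolp classical_sets.
From mathcomp Require Import mpoly.

Set Implicit Arguments.
Unset Strict Implicit.
Unset Printing Implicit Defensive.

Import Order.TTheory GRing.Theory Num.Theory.
Local Open Scope classical_set_scope.
Local Open Scope ring_scope.

Section Depth.
Variable R : comNzRingType.

Definition ideal_gen (G : set R) : set R :=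
  [set x | exists n (c g : 'I_n -> R),
     (forall i, G (g i)) /\ x = \sum_i c i * g i].

(* The last condition expresses multiplication by s`_i being injective
   modulo the ideal of its predecessors. *)
Definition regular_seq (s : seq R) : Prop :=
  ~ ideal_gen [set` s] 1 /\
  forall i x, (i < size s)%N ->
    ideal_gen [set` take i s] (s`_i * x) -> ideal_gen [set` take i s] x.

Definition regular_seq_in (I : set R) (s : seq R) : Prop :=
  regular_seq s /\ [set` s] `<=` I.

Definition depth_eq (I : set R) (n : nat) : Prop :=
  (exists2 s, regular_seq_in I s & size s = n) /\
  (forall s, regular_seq_in I s -> (size s <= n)%N).

End Depth.

Section AffineSemigroup.
Variable d : nat.

Definition submonoid_of n (a : 'I_n -> 'X_{1..d}) (P : pred 'I_n) :
    set 'X_{1..d} :=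
  [set m | exists c : 'I_n -> nat, m = (\sum_(i | P i) (a i *+ c i))%MM].

Definition affine_semigroup n (a : 'I_n -> 'X_{1..d}) : set 'X_{1..d} :=
  submonoid_of a predT.

Definition ratvec (m : 'X_{1..d}) : 'rV[rat]_d := \row_j (m j)%:R.

Definition genmx n (a : 'I_n -> 'X_{1..d}) : 'M[rat]_(n, d) :=
  \matrix_i ratvec (a i).

Definition pos n (a : 'I_n -> 'X_{1..d}) : set 'rV[rat]_d :=
  [set x | exists2 q : 'I_n -> rat,
     (forall i, 0 <= q i) & x = \sum_i q i *: ratvec (a i)].

Definition ray (m : 'X_{1..d}) : set 'rV[rat]_d :=
  [set x | exists2 q : rat, 0 <= q & x = q *: ratvec m].

Definition extremal_ray (C : set 'rV[rat]_d) (m : 'X_{1..d}) : Prop :=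
  m <> 0%MM /\ ray m `<=` C /\
  forall x y, C x -> C y -> ray m (x + y) -> ray m x /\ ray m y.

Definition firsts r (a : 'I_(d + r) -> 'X_{1..d}) : 'I_d -> 'X_{1..d} :=
  fun i => a (lshift r i).

(* The subgroup generated by the a i has the same rank as the rational matrix
   with rows a i; sa_minimal also forces the a i to be nonzero and pairwise
   distinct. *)
Record simplicial r (a : 'I_(d + r) -> 'X_{1..d}) : Prop := Simplicial {
  sa_minimal : forall i, ~ submonoid_of a (predC1 i) (a i);
  sa_rank : \rank (genmx a) = d;
  sa_free : row_free (genmx (firsts a));
  sa_cone : pos (firsts a) = pos a;
  (* implied by sa_free and sa_cone, recorded since the standing assumptions
     speak of the extremal ray of firsts a i *)
  sa_extremal : forall i, extremal_ray (pos a) (firsts a i);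
  sa_smallest : forall i j,
    ray (firsts a i) (ratvec (a j)) -> (firsts a i <= a j)%MM
}.

Section Order.
Variable S : set 'X_{1..d}.

(* y - x \in S, the difference being taken in Z^d *)
Definition semigroup_le (x y : 'X_{1..d}) : Prop :=
  exists2 s, S s & y = (x + s)%MM.

Definition Ap (b : 'X_{1..d}) : set 'X_{1..d} :=
  [set x | S x /\ ~ semigroup_le b x].

Definition has_maximal (X : set 'X_{1..d}) : Prop :=
  exists2 x, X x & forall y, X y -> semigroup_le x y -> y = x.

End Order.

Section SemigroupRing.
Variables (k : fieldType) (n : nat) (a : 'I_n -> 'X_{1..d}).

Definition semigroup_ring_pred : {pred {mpoly k[d]}} :=
  fun p => `[< [set` msupp p] `<=` affine_semigroup a >].

Lemma affine_semigroup0 : affine_semigroup a 0%MM.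
Proof. by exists (fun=> 0%N); rewrite big1. Qed.

Lemma affine_semigroupD x y : affine_semigroup a x -> affine_semigroup a y ->
  affine_semigroup a (x + y)%MM.
Proof.
move=> [c ->] [c' ->]; exists (fun i => (c i + c' i)%N).
rewrite -big_split /=; apply: eq_bigr => i _.
by apply/mnmP => j; rewrite mnmDE !mulmnE mulnDr.
Qed.

Fact semigroup_ring_closed : subring_closed semigroup_ring_pred.
Proof.
split.
- by apply/asboolP => m /=; rewrite msupp1 inE => /eqP ->;
    exact: affine_semigroup0.
- move=> p q /asboolP Sp /asboolP Sq; apply/asboolP => m /= /msuppB_le.
  by rewrite mem_cat => /orP[]; [exact: Sp | exact: Sq].
- move=> p q /asboolP Sp /asboolP Sq; apply/asboolP => m /= /msuppM_le.
  by case/allpairsP=> -[u v] /= [/Sp Su /Sq Sv ->]; exact: affine_semigroupD.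
Qed.

HB.instance Definition _ :=
  GRing.isSubringClosed.Build {mpoly k[d]} semigroup_ring_pred
    semigroup_ring_closed.

Record semigroup_ring := SemigroupRing {
  semigroup_ring_val : {mpoly k[d]};
  _ : semigroup_ring_val \in semigroup_ring_pred
}.

HB.instance Definition _ := [isSub for semigroup_ring_val].
HB.instance Definition _ := [Choice of semigroup_ring by <:].
HB.instance Definition _ :=
  [SubChoice_isSubComNzRing of semigroup_ring by <:].

Definition monomial_ideal : set semigroup_ring :=
  ideal_gen [set x : semigroup_ring |
    exists2 s, affine_semigroup a s /\ s <> 0%MM & val x = 'X_[s]].

End SemigroupRing.

End AffineSemigroup.

(* Main.v *)
Require Import Defs.
From mathcomp Require Import all_boot all_order all_algebra.
From mathcomp Require Import boolp classical_sets.
From mathcomp Require Import mpoly.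
From mathcomp Require Import zify ring.

Local Open Scope classical_set_scope.

(** Write S for the semigroup, R for its ring, e_1, e_2, e_3 for the extremal
    generators and x_i = t^(e_i).  Everything is read off from the points w of
    Z^3 that lie outside S and the directions in which a translate of w
    enters S.

    Depth at least two.  A maximal element u of Ap(b) is the same thing as a
    point w = u - b outside S with w + s in S for all s <> 0; this description
    does not mention b, which gives the equivalence of the two quantifiers
    ([has_maximal_Ap_indep]).  Such a u is a socle element of R/(t^b), and a
    regular sequence of length two in the maximal ideal forbids it
    ([regular_pair_no_maximal]).  Conversely, without maximal elements x_1 and
    x_2 + x_3 form a regular sequence: if x_2 + x_3 kills h modulo x_1, then
    comparing leading monomials shows that a power of x_2, hence one of x_3,
    kills h as well ([binomial_regular]), and a monomial of h outside (x_1)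
    would lie below a maximal element of Ap(e_1), by finiteness
    ([lower_set_has_maximal]).

    Depth at least three.  This is equivalent to [cm_criterion]: a point w with
    w + e_i and w + e_j in S for some i <> j is itself in S.  If it holds,
    x_1, x_2, x_3 is a regular sequence of monomials ([firsts_regular]).  If
    there is a regular sequence f_1, f_2, f_3 in the maximal ideal, then, as
    powers of the f's lie in (x_1, x_2, x_3), every linear syzygy of
    x_1, x_2, x_3 is a Koszul syzygy ([koszul_syzygy]).  Applied to the syzygy
    t^(w + e_j) x_i - t^(w + e_i) x_j = 0 this says that w is in S or that
    w - e_l is again a counterexample to the criterion, l being the third
    index; infinite descent leaves only the first case ([regular_triple_gap]).

    It remains to see that the criterion fails exactly when some intersection
    Ap(e_i) `&` Ap(e_j) has a maximal element ([cm_criterionPn]).  A maximal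
    element u yields a failure at u - e_i or u - e_j.  Conversely, let w be a
    failure for i and j.  Push w along - e_l as long as both the direction e_i
    and the direction e_j still lead into S; this stops, since the coordinate
    along e_l is nonnegative on S.  Say that one step further e_i no longer
    leads into S.  Moving along e_i until just before entering S one gets a
    point v such that v + e_i belongs to both Ap(e_i) and Ap(e_l) and, as e_j
    leads from v into S, only finitely many of its translates do; so
    Ap(e_i) `&` Ap(e_l) has a maximal element ([Ap_cap_has_maximal]).  The
    detour is necessary since at depth two no pair x_i, x_j need be regular, so
    that the maximal element is not simply a socle element modulo a regular
    pair: for instance, remove from N^3 the points on the three axes with an
    odd coordinate. *)

Section DepthOfAffineSemigroupRings.
Set Implicit Arguments.
Unset Strict Implicit.
Unset Printing Implicit Defensive.
Import Order.TTheory GRing.Theory Num.Theory.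
Local Open Scope ring_scope.

(** * Ideals, radicals and Koszul syzygies *)

Section Ideals.
Variable R : comNzRingType.
Implicit Types (s : seq R) (G : set R) (f x y c : R).

Lemma ideal_gen0 G : ideal_gen G 0.
Proof. by exists 0%N, (fun=> 0), (fun=> 0); split=> [[]|]; rewrite ?big_ord0. Qed.

Lemma ideal_genD G x y : ideal_gen G x -> ideal_gen G y -> ideal_gen G (x + y).
Proof.
move=> [m [c [g [Gg ->]]]] [n [e [h [Gh ->]]]].
exists (m + n)%N, (fun i => match split i with inl i => c i | inr i => e i end),
  (fun i => match split i with inl i => g i | inr i => h i end); split.
  by move=> i; case: (split i).
rewrite big_split_ord /=; congr (_ + _); apply: eq_bigr => i _.
  by rewrite -[lshift _ _]/(unsplit (inl i)) unsplitK.
by rewrite -[rshift _ _]/(unsplit (inr i)) unsplitK.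
Qed.

Lemma ideal_genM G c x : ideal_gen G x -> ideal_gen G (c * x).
Proof.
move=> [n [e [g [Gg ->]]]]; exists n, (fun i => c * e i), g; split=> //.
by rewrite mulr_sumr; apply: eq_bigr => i _; rewrite mulrA.
Qed.

Lemma ideal_genN G x : ideal_gen G (- x) <-> ideal_gen G x.
Proof. by split=> /(ideal_genM (- 1)); rewrite mulN1r ?opprK. Qed.

Lemma ideal_genB G x y : ideal_gen G x -> ideal_gen G y -> ideal_gen G (x - y).
Proof. by move=> Gx Gy; apply: ideal_genD => //; apply/ideal_genN. Qed.

Lemma mem_ideal_gen G x : G x -> ideal_gen G x.
Proof.
by move=> Gx; exists 1%N, (fun=> 1), (fun=> x); rewrite big_ord1 mul1r.
Qed.

Lemma ideal_gen_sum G (I : Type) (r : seq I) (P : pred I) (F : I -> R) :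
  (forall i, P i -> ideal_gen G (F i)) -> ideal_gen G (\sum_(i <- r | P i) F i).
Proof.
move=> GF; elim/big_ind: _ => //; [exact: ideal_gen0 | exact: ideal_genD].
Qed.

Lemma ideal_gen_ind G (P : R -> Prop) : P 0 ->
    (forall x y, P x -> P y -> P (x + y)) -> (forall c g, G g -> P (c * g)) ->
  forall x, ideal_gen G x -> P x.
Proof.
move=> P0 PD PM x [n [c [g [Gg ->]]]].
by apply: (big_ind P) => // i _; apply: PM.
Qed.

Lemma ideal_gen_sub G (H : set R) : G `<=` ideal_gen H ->
  ideal_gen G `<=` ideal_gen H.
Proof.
move=> GH; apply: ideal_gen_ind => [|x y|c g Gg].
- exact: ideal_gen0.
- exact: ideal_genD.
- by apply: ideal_genM; apply: GH.
Qed.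

Lemma ideal_gen_mulr G (H : set R) y : (forall g, G g -> ideal_gen H (g * y)) ->
  forall x, ideal_gen G x -> ideal_gen H (x * y).
Proof.
move=> GH; apply: ideal_gen_ind => [|x x' Hx Hx'|c g Gg].
- by rewrite mul0r; apply: ideal_gen0.
- by rewrite mulrDl; apply: ideal_genD.
- by rewrite -mulrA; apply/ideal_genM/GH.
Qed.

Lemma ideal_gen_seqP s x :
  ideal_gen [set` s] x <-> exists c : nat -> R, x = \sum_(i < size s) c i * s`_i.
Proof.
split=> [[n [c [g [sg ->]]]]|[c ->]]; last first.
  apply: ideal_gen_sum => i _; apply/ideal_genM/mem_ideal_gen.
  by rewrite /= mem_nth.
(* collect the coefficients of equal generators *)
exists (fun j => \sum_(i < n | index (g i) s == j) c i).
under [RHS]eq_bigr do rewrite mulr_suml.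
have lt_g i : (index (g i) s < size s)%N by rewrite index_mem; apply: sg.
rewrite (partition_big (fun i => Ordinal (lt_g i)) predT) //=.
apply: eq_bigr => j _; apply: eq_big => [i|i /eqP <-].
  by rewrite -val_eqE.
by rewrite /= nth_index //; apply: sg.
Qed.

Lemma ideal_gen_nilP x : ideal_gen [set` [::]] x <-> x = 0.
Proof.
split=> [/ideal_gen_seqP[c ->]|->]; [by rewrite big_ord0 | exact: ideal_gen0].
Qed.

Lemma ideal_gen1P f x : ideal_gen [set` [:: f]] x <-> exists c, x = c * f.
Proof.
split=> [/ideal_gen_seqP[c ->]|[c ->]].
  by exists (c 0%N); rewrite big_ord1.
by apply/ideal_genM/mem_ideal_gen; rewrite /= mem_head.
Qed.

Lemma ideal_gen2P f1 f2 x :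
  ideal_gen [set` [:: f1; f2]] x <-> exists c e, x = c * f1 + e * f2.
Proof.
split=> [/ideal_gen_seqP[c ->]|[c [e ->]]].
  by exists (c 0%N), (c 1%N); rewrite !big_ord_recl big_ord0 addr0.
by apply: ideal_genD; apply/ideal_genM/mem_ideal_gen; rewrite /= !inE eqxx ?orbT.
Qed.

Definition radical G : set R := [set x | exists n, ideal_gen G (x ^+ n)].

(** In the binomial expansion of the (m + n)-th power every term contains x to
    the power m or y to the power n. *)
Lemma radicalD G x y : radical G x -> radical G y -> radical G (x + y).
Proof.
move=> [m Gx] [n Gy]; exists (m + n)%N; rewrite exprDn.
apply: ideal_gen_sum => i _; rewrite -mulr_natl; apply: ideal_genM.
have [le_ni|/ltnW le_in] := leqP n i.
  by rewrite -(subnK le_ni) exprD mulrA; apply: ideal_genM.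
by rewrite -addnBA // exprD -mulrA mulrC; apply: ideal_genM.
Qed.

Lemma radicalM G c x : radical G x -> radical G (c * x).
Proof. by move=> [n Gx]; exists n; rewrite exprMn; apply: ideal_genM. Qed.

Lemma ideal_gen_radical G (H : set R) : G `<=` radical H ->
  ideal_gen G `<=` radical H.
Proof.
move=> GH; apply: ideal_gen_ind => [||c g Gg].
- by exists 1%N; rewrite expr1; apply: ideal_gen0.
- exact: radicalD.
- by apply: radicalM; apply: GH.
Qed.

Section Koszul.
Variables f1 f2 f3 x y z : R.
Hypothesis reg1 : forall u, f1 * u = 0 -> u = 0.
Hypothesis reg2 : forall u, ideal_gen [set` [:: f1]] (f2 * u) ->
  ideal_gen [set` [:: f1]] u.
Hypothesis reg3 : forall u, ideal_gen [set` [:: f1; f2]] (f3 * u) ->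
  ideal_gen [set` [:: f1; f2]] u.
Hypothesis rad : [set` [:: f1; f2; f3]] `<=` radical [set` [:: x; y; z]].

Let radP f : f \in [:: f1; f2; f3] ->
  exists n u v w, f ^+ n = u * x + v * y + w * z.
Proof.
move=> /rad[n] /ideal_gen_seqP[c fE]; exists n, (c 0%N), (c 1%N), (c 2%N).
by rewrite fE !big_ord_recl big_ord0 addr0 addrA.
Qed.

(** A power of f3 is a combination of x, y and z, hence multiplies c into the
    ideal (f1, f2), and f3 can be cancelled. *)
Lemma koszul_torsion_free c : ideal_gen [set` [:: f1; f2]] (c * x) ->
  ideal_gen [set` [:: f1; f2]] (c * y) -> ideal_gen [set` [:: f1; f2]] (c * z) ->
  ideal_gen [set` [:: f1; f2]] c.
Proof.
move=> Icx Icy Icz.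
have [|n [u [v [w fE]]]] := @radP f3; first by rewrite !inE eqxx !orbT.
have : ideal_gen [set` [:: f1; f2]] (f3 ^+ n * c).
  have -> : f3 ^+ n * c = u * (c * x) + v * (c * y) + w * (c * z).
    by rewrite fE; ring.
  by do !apply: ideal_genD; apply: ideal_genM.
elim: n {fE} => [|n IHn]; first by rewrite mul1r.
by rewrite exprS -mulrA => /reg3.
Qed.

(** Some power f2 ^+ n is a combination u x + v y + w z, and modulo f1 the
    cocycle f2 ^+ n (a, b, c) is (u a + v b + w c) (x, y, z).  A factor f2 can
    be removed: if f2 (a, b, c) = e (x, y, z) modulo f1, then e is killed by x, y
    and z modulo (f1, f2), so e is a multiple of f2 modulo f1. *)
Lemma koszul_cocycle a b c :
  ideal_gen [set` [:: f1]] (a * y - b * x) ->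
  ideal_gen [set` [:: f1]] (a * z - c * x) ->
  ideal_gen [set` [:: f1]] (b * z - c * y) ->
  exists e, [/\ ideal_gen [set` [:: f1]] (a - e * x),
    ideal_gen [set` [:: f1]] (b - e * y) & ideal_gen [set` [:: f1]] (c - e * z)].
Proof.
move=> Iab Iac Ibc.
have [|n [u [v [w fE]]]] := @radP f2; first by rewrite !inE eqxx !orbT.
have : exists e, [/\ ideal_gen [set` [:: f1]] (f2 ^+ n * a - e * x),
    ideal_gen [set` [:: f1]] (f2 ^+ n * b - e * y)
  & ideal_gen [set` [:: f1]] (f2 ^+ n * c - e * z)].
  exists (u * a + v * b + w * c); rewrite fE; split.
  - have -> : (u * x + v * y + w * z) * a - (u * a + v * b + w * c) * x =
      v * (a * y - b * x) + w * (a * z - c * x) by ring.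
    by apply: ideal_genD; apply: ideal_genM.
  - have -> : (u * x + v * y + w * z) * b - (u * a + v * b + w * c) * y =
      (- u) * (a * y - b * x) + w * (b * z - c * y) by ring.
    by apply: ideal_genD; apply: ideal_genM.
  - have -> : (u * x + v * y + w * z) * c - (u * a + v * b + w * c) * z =
      (- u) * (a * z - c * x) + (- v) * (b * z - c * y) by ring.
    by apply: ideal_genD; apply: ideal_genM.
elim: n {fE} => [|n IHn]; first by rewrite !mul1r.
rewrite exprS -!mulrA => -[e [Ia Ib Ic]].
have step t t' : ideal_gen [set` [:: f1]] (f2 * t - e * t') ->
    ideal_gen [set` [:: f1; f2]] (e * t').
  move=> /ideal_gen1P[p pE]; apply/ideal_gen2P; exists (- p), t.
  by rewrite mulNr -pE; ring.
have /ideal_gen2P[p [q eE]] :=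
  koszul_torsion_free (step _ _ Ia) (step _ _ Ib) (step _ _ Ic).
apply: IHn; exists q.
have {}step t t' : ideal_gen [set` [:: f1]] (f2 * t - e * t') ->
    ideal_gen [set` [:: f1]] (t - q * t').
  move=> /ideal_gen1P[p' pE]; apply: reg2; apply/ideal_gen1P.
  exists (p' + p * t').
  have -> : f2 * (t - q * t') = f2 * t - e * t' + p * t' * f1 by rewrite eE; ring.
  by rewrite pE; ring.
by split; apply: step.
Qed.

(** The vanishing of the first Koszul homology of x, y, z: the entries p, q, r
    say that (a, b, c) is the cross product of (x, y, z) with (r, - q, p).  The
    syzygy becomes of this form after multiplication by a power of f1.  A factor
    f1 can be removed, because (r, - q, p) is then a cocycle modulo f1, so
    [koszul_cocycle] makes it a multiple of (x, y, z) plus a multiple of f1,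
    and the former does not contribute to the cross product. *)
Lemma koszul_syzygy a b c : a * x + b * y + c * z = 0 ->
  exists p q r, [/\ a = p * y + q * z, b = r * z - p * x & c = - (q * x + r * y)].
Proof.
move=> abc0.
have [|n [u [v [w fE]]]] := @radP f1; first by rewrite !inE eqxx.
have : exists p q r, [/\ f1 ^+ n * a = p * y + q * z,
    f1 ^+ n * b = r * z - p * x & f1 ^+ n * c = - (q * x + r * y)].
  exists (v * a - u * b), (w * a - u * c), (w * b - v * c); rewrite fE; split.
  - transitivity (u * (a * x + b * y + c * z) + (v * a - u * b) * y
       + (w * a - u * c) * z); first by ring.
    by rewrite abc0; ring.
  - transitivity (v * (a * x + b * y + c * z) + (w * b - v * c) * z
       - (v * a - u * b) * x); first by ring.
    by rewrite abc0; ring.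
  - transitivity (w * (a * x + b * y + c * z) - ((w * a - u * c) * x
       + (w * b - v * c) * y)); first by ring.
    by rewrite abc0; ring.
elim: n {fE} => [|n IHn]; first by rewrite !mul1r.
rewrite exprS -!mulrA => -[p [q [r [aE bE cE]]]]; apply: IHn.
have [||| e [/ideal_gen1P[r' r'E] /ideal_gen1P[q' q'E] /ideal_gen1P[p' p'E]]] :=
  @koszul_cocycle r (- q) p.
- by apply/ideal_gen1P;
  exists (- (f1 ^+ n * c)); transitivity (- (f1 * (f1 ^+ n * c))); [rewrite cE|]; ring.
- by apply/ideal_gen1P;
  exists (f1 ^+ n * b); transitivity (f1 * (f1 ^+ n * b)); [rewrite bE|]; ring.
- by apply/ideal_gen1P;
  exists (- (f1 ^+ n * a)); transitivity (- (f1 * (f1 ^+ n * a))); [rewrite aE|]; ring.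
have rE : r = r' * f1 + e * x by rewrite -r'E; ring.
have qE : q = - (q' * f1 + e * y) by rewrite -q'E; ring.
have pE : p = p' * f1 + e * z by rewrite -p'E; ring.
have cancel (t t' : R) : f1 * t = f1 * t' -> t = t'.
  by move=> ftt; apply/eqP; rewrite -subr_eq0; apply/eqP/reg1; rewrite mulrBr ftt subrr.
exists p', (- q'), r'; split; apply: cancel.
- by rewrite aE pE qE; ring.
- by rewrite bE pE rE; ring.
- by rewrite cE rE qE; ring.
Qed.
End Koszul.
End Ideals.

(** * The divisibility order of an affine semigroup *)

(** Additive identities between exponents hold coordinatewise, where they are
    linear arithmetic. *)
Ltac mnm_lia :=
  let t := fresh "t" in
  apply/mnmP => t;
  repeat match goal with
  | H : _ = _ |- _ => move/mnmP/(_ t): H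
  end;
  rewrite ?(mnmDE, mulmnE, mnm0E); lia.

Section Order.
Variables (d n : nat) (a : 'I_n -> 'X_{1..d}).
Local Notation S := (affine_semigroup a).
Local Notation le := (semigroup_le S).

Lemma affine_semigroupMn s m : S s -> S (s *+ m)%MM.
Proof.
move=> Ss; elim: m => [|m IHm]; first by rewrite mulm0n; apply: affine_semigroup0.
by rewrite mulmS; apply: affine_semigroupD.
Qed.

Lemma affine_semigroup_gen i : S (a i).
Proof.
exists (fun j => nat_of_bool (j == i)); rewrite (bigD1 i) //= eqxx mulm1n.
rewrite big1 ?addm0 // => j /negPf ->; exact: mulm0n.
Qed.

Lemma semigroup_le_addr x y s : S s -> le x y -> le x (y + s)%MM.
Proof.
move=> Ss [t St ->]; exists (t + s)%MM; first exact: affine_semigroupD.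
by rewrite addmA.
Qed.

Lemma semigroup_le_addl x y s : S s -> le (x + s)%MM y -> le x y.
Proof.
move=> Ss [t St ->]; exists (t + s)%MM; first exact: affine_semigroupD.
mnm_lia.
Qed.

Lemma semigroup_le_trans x y z : le x y -> le y z -> le x z.
Proof. by move=> xy [s Ss ->]; apply: semigroup_le_addr. Qed.

Lemma semigroup_le_mulmn x y m : le x y -> le (x *+ m)%MM (y *+ m)%MM.
Proof.
move=> [s Ss ->]; exists (s *+ m)%MM; [exact: affine_semigroupMn | mnm_lia].
Qed.

Lemma Ap_lower b x s : S x -> S s -> Ap S b (x + s)%MM -> Ap S b x.
Proof.
by move=> Sx Ss [_ xsP]; split=> // bx; apply/xsP/semigroup_le_addr.
Qed.

Lemma has_maximalP (X : set 'X_{1..d}) : has_maximal S X <->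
  exists2 u, X u & forall s, S s -> s <> 0%MM -> ~ X (u + s)%MM.
Proof.
split=> -[u Xu uP]; exists u => //.
  move=> s Ss s0 Xus; apply: s0.
  have : (u + s)%MM = u by apply: uP => //; exists s.
  by move=> us; mnm_lia.
move=> y Xy [s Ss yE]; have [s0|/eqP/uP] := eqVneq s 0%MM.
  by rewrite yE s0 addm0.
by rewrite -yE => /(_ Ss).
Qed.

(** For u maximal in Ap b, the element u + b' - b of S is maximal in Ap b'. *)
Lemma has_maximal_Ap_indep b b' : S b' -> b' <> 0%MM ->
  has_maximal S (Ap S b) -> has_maximal S (Ap S b').
Proof.
move=> Sb' b'0 /has_maximalP[u [Su bu] uP].
have {}uP s : S s -> s <> 0%MM -> le b (u + s)%MM.
  move=> Ss s0; apply: contrapT => bus; apply: (uP _ Ss s0); split=> //.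
  exact: affine_semigroupD.
have [v Sv ubE] := uP _ Sb' b'0.
apply/has_maximalP; exists v.
  by split=> // -[t St vE]; apply: bu; exists t => //; mnm_lia.
move=> s Ss s0 [_]; apply; have [t St usE] := uP _ Ss s0.
by exists t => //; mnm_lia.
Qed.
End Order.


(** * Consequences of the cone condition *)

Section Cone.

Lemma common_denominator (I : finType) (q : I -> rat) : (forall i, 0 <= q i) ->
  exists2 D : nat, (0 < D)%N & exists c : I -> nat, forall i, q i * D%:R = (c i)%:R.
Proof.
move=> q0; exists (\prod_i `|denq (q i)|)%N.
  by apply: prodn_gt0 => i; rewrite absz_gt0 denq_eq0.
exists (fun i => `|numq (q i)| * \prod_(j | j != i) `|denq (q j)|)%N => i.
rewrite (bigD1 i) //= !natrM mulrA; congr (_ * _).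
rewrite -[LHS]/(q i * (`|denq (q i)|%N%:Z)%:~R) -[RHS]/((`|numq (q i)|%N%:Z)%:~R).
by rewrite !gez0_abs ?denq_ge0 ?numq_ge0 // numqE.
Qed.

Variables (d r : nat) (a : 'I_(d + r) -> 'X_{1..d}).
Hypothesis a_simp : simplicial a.
Local Notation S := (affine_semigroup a).
Local Notation le := (semigroup_le S).
Local Notation e := (firsts a).

Lemma ratvecD (x y : 'X_{1..d}) : ratvec (x + y)%MM = ratvec x + ratvec y.
Proof. by apply/rowP => j; rewrite !mxE mnmDE natrD. Qed.

Lemma ratvecMn (x : 'X_{1..d}) m : ratvec (x *+ m)%MM = m%:R *: ratvec x.
Proof. by apply/rowP => j; rewrite !mxE mulmnE mulnC natrM. Qed.

Lemma ratvec_sum (I : Type) (s : seq I) (P : pred I) (F : I -> 'X_{1..d}) :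
  ratvec (\sum_(i <- s | P i) F i)%MM = \sum_(i <- s | P i) ratvec (F i).
Proof.
elim/big_rec2: _ => [|i x y _ <-]; last exact: ratvecD.
by apply/rowP => j; rewrite !mxE mnm0E.
Qed.

Lemma ratvec_inj : injective (@ratvec d).
Proof.
move=> x y xy; apply/mnmP => j; apply/eqP; rewrite -(eqr_nat rat).
by have /rowP/(_ j) := xy; rewrite !mxE => ->.
Qed.

Lemma affine_semigroup_firsts i : S (e i).
Proof. exact: affine_semigroup_gen. Qed.

Lemma firsts_neq0 i : e i <> 0%MM.
Proof. by have [] := sa_extremal a_simp i. Qed.

Lemma affine_semigroup_pos s : S s -> pos e (ratvec s).
Proof.
move=> [c ->]; rewrite /e (sa_cone a_simp); exists (fun i => (c i)%:R) => //.
by rewrite ratvec_sum; apply: eq_bigr => i _; rewrite ratvecMn.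
Qed.

(** Clear denominators in an expression of s by the cone generators e. *)
Lemma multiple_ge_firsts s : S s -> s <> 0%MM ->
  exists m i, le (e i) (s *+ m)%MM.
Proof.
move=> Ss s0; have [q q0 sE] := affine_semigroup_pos Ss.
have [D D0 [c cE]] := common_denominator q0.
have sDE : (s *+ D)%MM = (\sum_i e i *+ c i)%MM.
  apply: ratvec_inj; rewrite ratvecMn sE ratvec_sum scaler_sumr.
  by apply: eq_bigr => i _; rewrite scalerA mulrC cE ratvecMn.
have [/forallP c0|] := boolP [forall i, c i == 0%N].
  case: s0; apply/mnmP => t; move/mnmP/(_ t): sDE.
  rewrite big1 => [|i _]; last by rewrite (eqP (c0 i)) mulm0n.
  by rewrite mulmnE mnm0E => /eqP; rewrite muln_eq0 (gtn_eqF D0) orbF => /eqP.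
rewrite negb_forall => /existsP[i ci]; exists D, i.
rewrite sDE (bigD1 i) //=; rewrite -lt0n in ci; rewrite -(prednK ci).
exists (e i *+ (c i).-1 + \sum_(j | j != i) e j *+ c j)%MM;
  last by rewrite mulmS addmA.
apply: affine_semigroupD; first exact/affine_semigroupMn/affine_semigroup_firsts.
elim/big_ind: _ => [|x y|j _]; first exact: affine_semigroup0.
  exact: affine_semigroupD.
exact/affine_semigroupMn/affine_semigroup_firsts.
Qed.

(** Each nonzero generator has a multiple above some e i; in an element of large
    degree some generator occurs often enough to provide N copies of e i. *)
Lemma large_degree_ge_firsts N : exists B, forall s, S s -> (B < mdeg s)%N ->
  exists i, le (e i *+ N)%MM s.
Proof.
have a_mul i : exists m, a i <> 0%MM -> exists p, le (e p) (a i *+ m)%MM.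
  have [->|/eqP ai0] := eqVneq (a i) 0%MM; first by exists 0%N.
  have [m [p ep]] := multiple_ge_firsts (affine_semigroup_gen a i) ai0.
  by exists m => _; exists p.
have {a_mul}[m mP] := choice a_mul.
exists (\sum_i mdeg (a i) * (m i * N))%N => s [c ->].
rewrite mdeg_sum => lt_s.
have [/forallP c_le|] :=
  boolP [forall i, mdeg (a i *+ c i)%MM <= mdeg (a i) * (m i * N)]%N.
  by move: lt_s; rewrite ltnNge leq_sum.
rewrite negb_forall => /existsP[i]; rewrite mdegMn -ltnNge => lt_i.
have ai0 : a i <> 0%MM by move=> ai0; move: lt_i; rewrite ai0 mdeg0.
have [p pP] := mP i ai0; exists p.
have lt_c : (m i * N < c i)%N by move: lt_i; rewrite ltn_mul2l => /andP[].
apply: (@semigroup_le_trans _ _ a _ (a i *+ m i *+ N)%MM).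
  exact: semigroup_le_mulmn.
exists (a i *+ (c i - m i * N) + \sum_(j | j != i) a j *+ c j)%MM.
  apply: affine_semigroupD; first exact/affine_semigroupMn/affine_semigroup_gen.
  elim/big_ind: _ => [|x y|j _]; first exact: affine_semigroup0.
    exact: affine_semigroupD.
  exact/affine_semigroupMn/affine_semigroup_gen.
rewrite (bigD1 i) //=; apply/mnmP => t; rewrite !(mnmDE, mulmnE) addnA -mulnA.
by rewrite -mulnDr subnKC // ltnW.
Qed.

(** The elements of X above u are u + s with s of bounded degree: by
    [large_degree_ge_firsts], an s of large degree leaves X along some e i.  One
    of largest degree is maximal. *)
Lemma lower_set_has_maximal (X : set 'X_{1..d}) u : X `<=` S ->
    (forall x s, S x -> S s -> X (x + s)%MM -> X x) -> X u ->
    (forall i, exists m, ~ X (u + e i *+ m)%MM) ->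
  has_maximal S X.
Proof.
move=> XS Xlow Xu /choice[m mP].
have [B BP] := large_degree_ge_firsts (\max_i m i).
have {}BP s : S s -> X (u + s)%MM -> (mdeg s <= B)%N.
  move=> Ss Xus; rewrite leqNgt; apply/negP => /(BP _ Ss)[i [t St sE]].
  have le_mi : (m i <= \max_i m i)%N by apply: leq_bigmax.
  apply: (mP i); apply: (Xlow _ (e i *+ (\max_i m i - m i) + t)%MM).
  - apply: affine_semigroupD; first exact: XS.
    exact/affine_semigroupMn/affine_semigroup_firsts.
  - apply: affine_semigroupD => //.
    exact/affine_semigroupMn/affine_semigroup_firsts.
  suff -> : (u + e i *+ m i + (e i *+ (\max_i m i - m i) + t) = u + s)%MM by [].
  rewrite sE -{2}(subnKC le_mi); mnm_lia.
have exs : exists k, `[< exists s, [/\ S s, X (u + s)%MM & mdeg s = k] >].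
  exists 0%N; apply/asboolP; exists 0%MM; rewrite addm0 mdeg0.
  by split=> //; apply: affine_semigroup0.
have [|k /asboolP[s [Ss Xus sk]] kmax] := @ex_maxnP _ B exs.
  by move=> k /asboolP[s [Ss Xus <-]]; apply: BP.
apply/has_maximalP; exists (u + s)%MM => // t St t0 Xust.
have /kmax : `[< exists s', [/\ S s', X (u + s')%MM & mdeg s' = mdeg (s + t)%MM] >].
  apply/asboolP; exists (s + t)%MM; rewrite addmA.
  by split=> //; apply: affine_semigroupD.
rewrite mdegD sk -[X in (_ <= X)%N]addn0 leq_add2l leqn0 mdeg_eq0.
by move=> /eqP.
Qed.

(** The i-th coordinate in the rational basis e, nonnegative on S because S lies
    in the cone spanned by e. *)
Lemma dual_coordinate i : exists lambda : 'X_{1..d} -> rat,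
  [/\ {morph lambda : x y / (x + y)%MM >-> x + y},
      forall j m, lambda (e j *+ m)%MM = (m * (j == i))%:R
    & forall s, S s -> 0 <= lambda s].
Proof.
pose U := Defs.genmx e.
have Uunit : U \in unitmx by rewrite -row_free_unit; apply: sa_free.
pose lambda (x : 'rV[rat]_d) := (x *m invmx U) 0 i.
have lambdaE j : lambda (ratvec (e j)) = (j == i)%:R.
  rewrite /lambda; have -> : ratvec (e j) = row j U by apply/rowP => t; rewrite !mxE.
  by rewrite -row_mul mulmxV // !mxE.
have lambdaZ c x : lambda (c *: x) = c * lambda x by rewrite /lambda -scalemxAl mxE.
exists (fun x => lambda (ratvec x)); split.
- by move=> x y; rewrite ratvecD /lambda mulmxDl mxE.
- by move=> j m; rewrite ratvecMn lambdaZ lambdaE natrM.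
move=> s /affine_semigroup_pos[q q0 ->].
rewrite /lambda mulmx_suml summxE; apply: sumr_ge0 => j _.
by rewrite -[X in 0 <= X]/(lambda _) lambdaZ lambdaE mulr_ge0.
Qed.

Lemma firsts_inj : injective e.
Proof.
move=> i j eij; have [lambda [_ lambdaE _]] := dual_coordinate i.
have := lambdaE j 1%N; rewrite mulm1n -eij -[e i]mulm1n lambdaE eqxx mul1n.
by case: eqP => // _ /eqP; rewrite oner_eq0.
Qed.

(** The coordinate along e l is insensitive to e i and bounds m. *)
Lemma slide_bounded x y i l : i != l ->
  exists B, forall m N, le (x + e l *+ m)%MM (y + e i *+ N)%MM -> (m <= B)%N.
Proof.
move=> il; have [lambda [lambdaD lambdaE lambda_ge0]] := dual_coordinate l.
exists (Num.truncn (lambda y - lambda x)) => m N [s Ss] /(congr1 lambda).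
rewrite !lambdaD !lambdaE eqxx (negPf il) muln1 muln0 addr0 => yE.
have mE : lambda y - lambda x - m%:R = lambda s by rewrite yE; ring.
have m_le : m%:R <= lambda y - lambda x by rewrite -subr_ge0 mE lambda_ge0.
by rewrite truncn_ge_nat // (le_trans _ m_le) // ler0n.
Qed.

(** The element w of Z^d with w + e i and w + e j in S is encoded by the pair
    x = w + e i, y = w + e j, as exponents have no negative entries. *)
Definition cm_criterion := forall i j, i != j -> forall x y, S x -> S y ->
  (x + e j)%MM = (y + e i)%MM -> le (e i) x.

(** Here x and y stand for the point y - x of Z^d.  With n.+1 the least
    multiple of e i that brings it into S, the element u = y - x + n.+1 e i lies
    in Ap (e i) and Ap (e l), and u leaves the intersection in each of the three
    directions. *)
Lemma Ap_cap_has_maximal x y i j l : (forall p, p \in [:: i; j; l]) ->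
    ~ le x y -> (exists N, le x (y + e i *+ N)%MM) ->
    (exists N, le x (y + e j *+ N)%MM) ->
    (forall N, ~ le (x + e l)%MM (y + e i *+ N)%MM) ->
  has_maximal S (Ap S (e i) `&` Ap S (e l)).
Proof.
move=> ijl xy [Ni iP] [Nj [s Ss jP]] lP.
have exn : exists n, `[< le x (y + e i *+ n)%MM >] by exists Ni; apply/asboolP.
case: (ex_minnP exn) => -[|n] /asboolP[u Su uE] nmin.
  by case: xy; exists u => //; mnm_lia.
have lt_n : ~ le x (y + e i *+ n)%MM.
  by move=> /asboolP/nmin; rewrite ltnn.
have Sei := affine_semigroup_firsts i.
have Apu : (Ap S (e i) `&` Ap S (e l)) u.
  split; split=> // -[t St tE].
    by apply: lt_n; exists t => //; mnm_lia.
  by apply: (lP n.+1); exists t => //; mnm_lia.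
apply: (lower_set_has_maximal _ _ Apu); first by move=> ? [[]].
  by move=> v t Sv St [Ai Al]; split; apply: Ap_lower Sv St _.
move=> p; have := ijl p; rewrite !inE => /or3P[] /eqP ->.
- by exists 1%N => -[[_]]; case; exists u => //; mnm_lia.
- exists Nj => -[[_]]; case; exists (s + e i *+ n)%MM; last by mnm_lia.
  exact/affine_semigroupD/affine_semigroupMn.
- by exists 1%N => -[_ [_]]; case; exists u => //; mnm_lia.
Qed.

(** The point y - x, outside S, enters S along e i and along e j.  It is moved
    by multiples of - e l as far as both directions still lead into S; the
    direction that fails first takes the role of i in [Ap_cap_has_maximal]. *)
Lemma gap_Ap_cap_has_maximal x y i j l : i != l -> j != l ->
    (forall p, p \in [:: i; j; l]) -> ~ le x y ->
    le x (y + e i)%MM -> le x (y + e j)%MM ->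
  has_maximal S (Ap S (e i) `&` Ap S (e l)) \/
  has_maximal S (Ap S (e j) `&` Ap S (e l)).
Proof.
move=> il jl ijl xy xi xj.
pose reach p m := exists N, le (x + e l *+ m)%MM (y + e p *+ N)%MM.
have reach_max p : p != l -> le x (y + e p)%MM ->
    exists2 m, reach p m & forall m', reach p m' -> (m' <= m)%N.
  move=> pl xp; have [B BP] := slide_bounded x y pl.
  have ex0 : exists m, `[< reach p m >].
    by exists 0%N; apply/asboolP; exists 1%N; rewrite mulm0n addm0 mulm1n.
  have [|m /asboolP m_reach mmax] := @ex_maxnP _ B ex0.
    by move=> m /asboolP[N /BP].
  by exists m => // m' /asboolP/mmax.
have reach_le p m m' : (m <= m')%N -> reach p m' -> reach p m.
  move=> le_m [N reach_m']; exists N.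
  apply: (@semigroup_le_addl _ _ _ _ _ (e l *+ (m' - m))%MM).
    exact/affine_semigroupMn/affine_semigroup_firsts.
  suff -> : (x + e l *+ m + e l *+ (m' - m) = x + e l *+ m')%MM by [].
  by rewrite -{2}(subnKC le_m); mnm_lia.
have xy' m : ~ le (x + e l *+ m)%MM y.
  move=> /semigroup_le_addl xy'; apply/xy/xy'.
  exact/affine_semigroupMn/affine_semigroup_firsts.
have last_step p m N : (forall m', reach p m' -> (m' <= m)%N) ->
    ~ le (x + e l *+ m + e l)%MM (y + e p *+ N)%MM.
  move=> mmax reach_m; suff /mmax : reach p m.+1 by rewrite ltnn.
  by exists N; rewrite mulmS [(e l + _)%MM]addmC addmA.
have [mi reach_i mimax] := reach_max i il xi.
have [mj reach_j mjmax] := reach_max j jl xj.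
have [le_ij|/ltnW le_ji] := leqP mi mj.
  left; apply: (@Ap_cap_has_maximal (x + e l *+ mi)%MM y i j l) => //.
    exact: reach_le le_ij reach_j.
  by move=> N; apply: last_step.
right; apply: (@Ap_cap_has_maximal (x + e l *+ mj)%MM y j i l) => //.
- by move=> p; move: (ijl p); rewrite !inE orbCA.
- exact: reach_le le_ji reach_i.
- by move=> N; apply: last_step.
Qed.

(** For u in the intersection, u + e l stays in it: if u + e l = e i + s, the
    criterion for the indices i and l would put e i below u. *)
Lemma cm_criterion_no_maximal i j l : i != l -> j != l ->
  cm_criterion -> ~ has_maximal S (Ap S (e i) `&` Ap S (e j)).
Proof.
move=> il jl cm /has_maximalP[u [[Su iu] [_ ju]] uP].
have Sul : S (u + e l)%MM := affine_semigroupD Su (affine_semigroup_firsts l).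
apply: (uP _ (affine_semigroup_firsts l) (firsts_neq0 (i:=l))).
by split; split=> // -[s Ss usE]; [apply: iu | apply: ju]; apply: (cm _ l _ u s);
  rewrite // usE addmC.
Qed.
End Cone.

(** * Monomials in the semigroup ring *)

Section SemigroupRing.
Variables (d : nat) (k : fieldType) (n : nat) (a : 'I_n -> 'X_{1..d}).
Local Notation S := (affine_semigroup a).
Local Notation le := (semigroup_le S).
Local Notation R := (semigroup_ring k a).
Implicit Types (p q f g h : R) (u s b : 'X_{1..d}).

Let val0 : val (0 : R) = 0. Proof. exact: rmorph0. Qed.
Let val1 : val (1 : R) = 1. Proof. exact: rmorph1. Qed.
Let valD p q : val (p + q) = val p + val q. Proof. exact: rmorphD. Qed.
Let valB p q : val (p - q) = val p - val q. Proof. exact: rmorphB. Qed.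
Let valM p q : val (p * q) = val p * val q. Proof. exact: rmorphM. Qed.
Let valX p m : val (p ^+ m) = val p ^+ m. Proof. exact: rmorphXn. Qed.

(** Junk value 0 for exponents outside S. *)
Definition term (c : k) s : R := insubd (0 : R) (c *: 'X_[s]).
Definition mono s : R := term 1 s.

Lemma val_term c s : S s -> val (term c s) = c *: 'X_[s].
Proof.
move=> Ss; apply: insubdK; apply/asboolP => m /= /msuppZ_le.
by rewrite msuppX inE => /eqP ->.
Qed.

Lemma val_mono s : S s -> val (mono s) = 'X_[s].
Proof. by move=> Ss; rewrite val_term // scale1r. Qed.

Lemma msupp_semigroup_ring p u : u \in msupp (val p) -> S u.
Proof. by move=> pu; have /asboolP/(_ u pu) := valP p. Qed.

Lemma monoM s t : S s -> S t -> mono s * mono t = mono (s + t)%MM.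
Proof.
move=> Ss St; apply: val_inj; have Sst : S (s + t)%MM := affine_semigroupD Ss St.
by rewrite valM !val_mono // mpolyXD.
Qed.

Lemma monoXn s m : S s -> mono s ^+ m = mono (s *+ m)%MM.
Proof.
move=> Ss; apply: val_inj; rewrite valX !val_mono ?mpolyXn //.
exact: affine_semigroupMn.
Qed.

Lemma termM c s t : S s -> S t -> term c s * mono t = term c (s + t)%MM.
Proof.
move=> Ss St; apply: val_inj; have Sst : S (s + t)%MM := affine_semigroupD Ss St.
by rewrite valM !val_term // mpolyXD scale1r scalerAl.
Qed.

Lemma sum_terms p : p = \sum_(u <- msupp (val p)) term (val p)@_u u.
Proof.
apply: val_inj; rewrite (rmorph_sum val) [LHS]mpolyE big_seq [RHS]big_seq.
by apply: eq_bigr => u pu; rewrite /= val_term //; apply: msupp_semigroup_ring pu.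
Qed.

(** The semigroup ring is a subring of a polynomial ring over a field. *)
Lemma semigroup_ring_mulfI f : f != 0 -> injective ( *%R f).
Proof.
move=> f0 g h /(congr1 val); rewrite !valM => /mulfI fgh.
by apply/val_inj/fgh; rewrite -(inj_eq val_inj) in f0.
Qed.

Lemma mono_neq0 s : S s -> mono s != 0.
Proof.
by move=> Ss; rewrite -(inj_eq val_inj) val_mono // -msupp_eq0 msuppX.
Qed.

Lemma msupp_mulmono p s u : S s -> (u \in msupp (val (p * mono s))) =
  (u \in [seq (s + v)%MM | v <- msupp (val p)]).
Proof. by move=> Ss; rewrite valM val_mono // (perm_mem (msuppMX _ _)). Qed.

(** An element is the sum of its terms, and a term whose exponent lies above b is a
    multiple of t^b; conversely, sums and multiples create no other exponents. *)
Lemma ideal_monoP (bs : seq 'X_{1..d}) p : (forall b, b \in bs -> S b) ->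
  ideal_gen [set` map mono bs] p <->
  (forall u, u \in msupp (val p) -> exists2 b, b \in bs & le b u).
Proof.
move=> Sbs; split; last first.
  move=> pP; rewrite [p]sum_terms big_seq; apply: ideal_gen_sum => u pu.
  have [b bbs [s Ss ->]] := pP u pu; rewrite addmC -termM //; last exact: Sbs.
  by apply/ideal_genM/mem_ideal_gen; apply: map_f.
move: p; apply: ideal_gen_ind.
- by move=> u; rewrite val0 msupp0.
- move=> q q' qP q'P u; rewrite valD => /msuppD_le.
  by rewrite mem_cat => /orP[/qP|/q'P].
- move=> c _ /mapP[b bbs ->] u.
  rewrite msupp_mulmono => [/mapP|]; last exact: Sbs.
  move=> [v cv ->]; exists b => //.
  by exists v => //; apply: msupp_semigroup_ring cv.
Qed.

Lemma ideal_mono1P b p : S b -> ideal_gen [set` [:: mono b]] p <->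
  (forall u, u \in msupp (val p) -> le b u).
Proof.
move=> Sb; rewrite (@ideal_monoP [:: b]); last by move=> ?; rewrite inE => /eqP ->.
by split=> pP u /pP => [[b']|]; [rewrite inE => /eqP -> | exists b; rewrite ?inE].
Qed.

Lemma ideal_mono_memP (bs : seq 'X_{1..d}) s : (forall b, b \in bs -> S b) ->
  S s -> ideal_gen [set` map mono bs] (mono s) <-> exists2 b, b \in bs & le b s.
Proof.
move=> Sbs Ss; rewrite ideal_monoP // val_mono // msuppX.
split=> [|bP u]; first by apply; rewrite inE.
by rewrite inE => /eqP ->.
Qed.

Lemma monomial_ideal_msupp0 p : monomial_ideal p -> 0%MM \notin msupp (val p).
Proof.
move: p; apply: ideal_gen_ind.
- by rewrite val0 msupp0.
- move=> q q' q0 q'0; rewrite valD; apply/negP => /msuppD_le.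
  by rewrite mem_cat (negPf q0) (negPf q'0).
- move=> c g [s [Ss s0] gE]; rewrite valM gE.
  rewrite (perm_mem (msuppMX _ _)); apply/mapP => -[v _ sv0].
  by apply: s0; mnm_lia.
Qed.

Lemma monomial_ideal_mono s : S s -> s <> 0%MM -> monomial_ideal (mono s).
Proof.
by move=> Ss s0; apply: mem_ideal_gen; exists s => //; rewrite val_mono.
Qed.

Lemma monomial_ideal_proper (s : seq R) : [set` s] `<=` @monomial_ideal d k n a ->
  ~ ideal_gen [set` s] 1.
Proof.
move=> sm /(ideal_gen_sub sm)/monomial_ideal_msupp0.
by rewrite val1 msupp1 inE eqxx.
Qed.

(** For u maximal in Ap b, the maximal ideal multiplies t^u into (t^b), say
    f t^u = h1 t^b and g t^u = h2 t^b.  Then g h1 = f h2, so h1 is a multiple of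
    f by regularity of g, and cancelling f puts t^u in (t^b). *)
Lemma regular_pair_no_maximal f g b : S b ->
    monomial_ideal f -> monomial_ideal g ->
    (forall h, f * h = 0 -> h = 0) ->
    (forall h, ideal_gen [set` [:: f]] (g * h) -> ideal_gen [set` [:: f]] h) ->
  ~ has_maximal S (Ap S b).
Proof.
move=> Sb mf mg f_reg g_reg /has_maximalP[u [Su bu] uP].
have socle h : monomial_ideal h -> exists c, h * mono u = c * mono b.
  move=> mh; apply/ideal_gen1P; apply: ideal_gen_mulr mh => p [s [Ss s0] pE].
  have -> : p = mono s by apply: val_inj; rewrite val_mono.
  rewrite monoM //.
  rewrite addmC; apply/(@ideal_mono_memP [:: b]).
  - by move=> ?; rewrite inE => /eqP ->.
  - exact: affine_semigroupD.
  exists b; rewrite ?inE //; apply: contrapT => bus.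
  by apply: (uP _ Ss s0); split=> //; apply: affine_semigroupD.
have [h1 fE] := socle f mf; have [h2 gE] := socle g mg.
have gh : g * h1 = h2 * f.
  apply: (semigroup_ring_mulfI (mono_neq0 Sb)).
  transitivity (g * (h1 * mono b)); first by ring.
  rewrite -fE; transitivity (f * (g * mono u)); first by ring.
  by rewrite gE; ring.
have /ideal_gen1P[c h1E] : ideal_gen [set` [:: f]] h1.
  by apply/g_reg/ideal_gen1P; exists h2.
have uE : mono u = c * mono b.
  apply/eqP; rewrite -subr_eq0; apply/eqP/f_reg.
  by rewrite mulrBr fE h1E; ring.
have /(@ideal_mono_memP [:: b]) : ideal_gen [set` [:: mono b]] (mono u).
  by apply/ideal_gen1P; exists c.
case=> // [?|b']; first by rewrite inE => /eqP ->.
by rewrite inE => /eqP ->.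
Qed.

(** The leading monomial of (t^s + t^t) h is s + u with u the leading monomial
    of h, so t^s kills the leading term of h modulo t^b.  Hence t^s h is congruent
    to a multiple of h minus its leading term, which has fewer monomials and is
    again killed by t^s + t^t. *)
Lemma binomial_torsion_power b s t h : S b -> S s -> S t -> (t < s)%O ->
    ideal_gen [set` [:: mono b]] ((mono s + mono t) * h) ->
  exists m, ideal_gen [set` [:: mono b]] (mono s ^+ m * h).
Proof.
move=> Sb Ss St lt_ts; have [N] := ubnP (size (msupp (val h))).
elim: N h => // N IHN h; rewrite ltnS => le_h Ih.
have [->|h0] := eqVneq h 0; first by exists 0%N; rewrite mulr0; apply: ideal_gen0.
have vh0 : val h != 0 by rewrite -(inj_eq val_inj) in h0.
set u := mlead (val h); have hu : u \in msupp (val h) by apply: mlead_supp.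
have Su : S u by apply: msupp_semigroup_ring hu.
have lead_st : mlead (val (mono s + mono t)) = s.
  rewrite valD !val_mono // mleadDl ?mleadXm //.
have st0 : val (mono s + mono t) != 0.
  apply: contraTneq lt_ts => st0; rewrite -leNgt.
  by rewrite -lead_st st0 mlead0 le0x.
have bsu : le b (s + u)%MM.
  have <- : mlead (val ((mono s + mono t) * h)) = (s + u)%MM.
    by rewrite valM mleadM // lead_st.
  have /(ideal_mono1P _ Sb) := Ih; apply; apply: mlead_supp.
  by rewrite valM mulf_neq0.
pose h' := h - term (val h)@_u u.
have Ihh' : ideal_gen [set` [:: mono b]] (mono s * h - mono s * h').
  rewrite -mulrBr /h' opprB addrC subrK mulrC termM //; apply/ideal_mono1P => // v.
  rewrite val_term; last exact: affine_semigroupD.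
  by move/msuppZ_le; rewrite msuppX inE addmC => /eqP ->.
have [||m Im] := IHN (h' * mono s).
- have -> : size (msupp (val (h' * mono s))) = size (msupp (val h')).
    rewrite valM val_mono // (perm_size (msuppMX _ _)) size_map //.
  rewrite /h' valB val_term // (perm_size (msupp_rem _ _)) size_rem //.
  by rewrite prednK //; case: (msupp _) hu.
- have -> : (mono s + mono t) * (h' * mono s) = mono s * ((mono s + mono t) * h) -
     (mono s + mono t) * (mono s * h - mono s * h') by ring.
  by apply: ideal_genB; apply: ideal_genM.
exists m.+1; rewrite exprSr -mulrA.
have -> : mono s ^+ m * (mono s * h) = mono s ^+ m * (h' * mono s) +
  mono s ^+ m * (mono s * h - mono s * h') by ring.
by apply: ideal_genD => //; apply: ideal_genM.
Qed.

(** Modulo t^b and on an h killed by t^s + t^t, the monomials t^s and t^t act as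
    opposites, so a power of one kills h as soon as the same power of the other
    does. *)
Lemma binomial_regular b s t : S b -> S s -> S t -> s != t ->
    (forall u, S u -> (exists m, le b (u + s *+ m)%MM) ->
       (exists m, le b (u + t *+ m)%MM) -> le b u) ->
  forall h, ideal_gen [set` [:: mono b]] ((mono s + mono t) * h) ->
    ideal_gen [set` [:: mono b]] h.
Proof.
move=> Sb Ss St; wlog lt_ts : s t Ss St / (t < s)%O => [IH|] st bP h Ih.
  have /orP[lt_st|lt_ts] := lt_total st; last exact: (IH s t).
  apply: (IH t s) => //; first by rewrite eq_sym.
  - by move=> u Su tu su; apply: bP.
  - by rewrite addrC.
have [m Ims] := binomial_torsion_power Sb Ss St lt_ts Ih.
have Imt : ideal_gen [set` [:: mono b]] (mono t ^+ m * h).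
  have : ideal_gen [set` [:: mono b]] ((mono t ^+ m - (- mono s) ^+ m) * h).
    rewrite subrXX opprK [mono t + _]addrC mulrAC.
    by rewrite mulrC; apply: ideal_genM.
  rewrite mulrBl => It; rewrite -[_ * h](subrK ((- mono s) ^+ m * h)).
  apply: ideal_genD => //; rewrite exprNn -mulrA; exact: ideal_genM.
apply/ideal_mono1P => // u hu; have Su := msupp_semigroup_ring hu.
have shift v : S v -> ideal_gen [set` [:: mono b]] (mono v ^+ m * h) ->
    exists m, le b (u + v *+ m)%MM.
  move=> Sv; have Svm : S (v *+ m)%MM by apply: affine_semigroupMn.
  rewrite monoXn // mulrC => /(ideal_mono1P _ Sb) vP; exists m.
  by apply: vP; rewrite msupp_mulmono // addmC map_f.
by apply: bP => //; apply: shift.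
Qed.
End SemigroupRing.

(** * Regular sequences and the extremal generators *)

Section Depth.

Variables (d r : nat) (k : fieldType) (a : 'I_(d + r) -> 'X_{1..d}).
Hypothesis a_simp : simplicial a.
Local Notation S := (affine_semigroup a).
Local Notation le := (semigroup_le S).
Local Notation e := (firsts a).
Local Notation mono := (@mono d k (d + r) a).
Local Notation maxid := (@monomial_ideal d k (d + r) a).
Variables i j l : 'I_d.
Hypothesis ijl : forall p, p \in [:: i; j; l].

Let Se p : S (e p). Proof. exact: affine_semigroup_firsts. Qed.

Let me p : maxid (mono (e p)).
Proof.
by apply: monomial_ideal_mono; [apply: Se | apply: (firsts_neq0 a_simp)].
Qed.

(** Each nonzero s in S has a multiple above some e p, so a power of t^s is a
    multiple of t^(e p). *)
Lemma monomial_ideal_radical :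
  maxid `<=` radical [set` [:: mono (e i); mono (e j); mono (e l)]].
Proof.
apply: ideal_gen_radical => g [s [Ss /eqP s0] gE].
have -> : g = mono s by apply: val_inj; rewrite val_mono.
have [N [p [t St sNE]]] := multiple_ge_firsts a_simp Ss (elimN eqP s0).
exists N; rewrite monoXn //; apply/(@ideal_mono_memP _ _ _ _ [:: e i; e j; e l]).
- by move=> b; rewrite !inE => /or3P[] /eqP ->; exact: Se.
- exact: affine_semigroupMn.
exists (e p); last by exists t.
by move: (ijl p); rewrite !inE => /or3P[] /eqP ->; rewrite eqxx ?orbT.
Qed.

(** Monomial by monomial, the criterion for i and j is regularity of the second
    element, and the criterion for i, l and for j, l that of the third. *)
Lemma firsts_regular : i != j -> i != l -> j != l -> cm_criterion a ->
  regular_seq_in maxid [:: mono (e i); mono (e j); mono (e l)].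
Proof.
move=> ij il jl cm.
have sub_m : [set` [:: mono (e i); mono (e j); mono (e l)]] `<=` maxid.
  by move=> f; rewrite /= !inE => /or3P[] /eqP ->; apply: me.
split=> //; split; first exact: monomial_ideal_proper.
move=> [|[|[|//]]] h _ /=.
- move=> /ideal_gen_nilP fh; apply/ideal_gen_nilP.
  by apply: (semigroup_ring_mulfI (mono_neq0 k (Se i))); rewrite fh mulr0.
- move=> /(ideal_mono1P _ (Se i)) hP; apply/(ideal_mono1P _ (Se i)) => u hu.
  have Su := msupp_semigroup_ring hu.
  have [|s Ss us] := hP (e j + u)%MM.
    by rewrite mulrC (msupp_mulmono _ _ (Se j)) map_f.
  by apply: (cm i j _ u s) => //; rewrite addmC us addmC.
have Sij b : b \in [:: e i; e j] -> S b by rewrite !inE => /orP[] /eqP ->.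
move=> /(@ideal_monoP _ _ _ _ [:: e i; e j] _ Sij) hP.
apply/(@ideal_monoP _ _ _ _ [:: e i; e j]) => // u hu.
have Su := msupp_semigroup_ring hu.
have [|b] := hP (e l + u)%MM; first by rewrite mulrC (msupp_mulmono _ _ (Se l)) map_f.
rewrite !inE => bij [s Ss us]; exists b; first by rewrite !inE.
by case/orP: bij us => /eqP -> us; apply: (cm _ l _ u s); rewrite // addmC us addmC.
Qed.

(** With z = x - e i = y - e j, [koszul_syzygy] applied to
    t^y t^(e i) - t^x t^(e j) + 0 t^(e l) = 0 shows that z is in S or that
    x - e l and y - e l are in S, a relation of the same form in smaller
    degree. *)
Lemma regular_triple_gap f1 f2 f3 :
    maxid f1 -> maxid f2 -> maxid f3 -> (forall h, f1 * h = 0 -> h = 0) ->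
    (forall h, ideal_gen [set` [:: f1]] (f2 * h) -> ideal_gen [set` [:: f1]] h) ->
    (forall h, ideal_gen [set` [:: f1; f2]] (f3 * h) ->
       ideal_gen [set` [:: f1; f2]] h) ->
  forall x y, S x -> S y -> (x + e j)%MM = (y + e i)%MM -> le (e i) x.
Proof.
move=> mf1 mf2 mf3 reg1 reg2 reg3 x; have [N] := ubnP (mdeg x).
elim: N x => // N IHN x; rewrite ltnS => le_x y Sx Sy xyE.
have rad : [set` [:: f1; f2; f3]] `<=`
    radical [set` [:: mono (e i); mono (e j); mono (e l)]].
  by move=> f; rewrite /= !inE => /or3P[] /eqP ->; apply: monomial_ideal_radical.
have syz : mono y * mono (e i) + (- mono x) * mono (e j) + 0 * mono (e l) = 0.
  by rewrite mul0r addr0 mulNr (monoM k Sy (Se i)) (monoM k Sx (Se j)) xyE subrr.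
have [p [q [t [yE xE _]]]] := koszul_syzygy reg1 reg2 reg3 rad syz.
have S2 b b' : S b -> S b' -> forall b0, b0 \in [:: b; b'] -> S b0.
  by move=> Sb Sb' b0; rewrite !inE => /orP[] /eqP ->.
have [b] : exists2 b, b \in [:: e j; e l] & le b y.
  apply/(@ideal_mono_memP _ k _ a [:: e j; e l]) => //; first exact: S2.
  by apply/ideal_gen2P; exists p, q.
rewrite !inE => /orP[] /eqP -> [y' Sy' y'E].
  by exists y' => //; mnm_lia.
have [b'] : exists2 b, b \in [:: e i; e l] & le b x.
  apply/(@ideal_mono_memP _ k _ a [:: e i; e l]) => //; first exact: S2.
  apply/ideal_gen2P; exists p, (- t).
  by apply: oppr_inj; rewrite xE opprD mulNr opprK addrC.
rewrite !inE => /orP[] /eqP -> [x' Sx' x'E]; first by exists x'.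
rewrite x'E addmC; apply: semigroup_le_addr; first exact: Se.
apply: (IHN x' _ y') => //.
  apply: leq_trans le_x; rewrite x'E mdegD -[X in (X < _)%N]add0n ltn_add2r.
  by rewrite lt0n mdeg_eq0; apply/eqP/(firsts_neq0 a_simp).
by mnm_lia.
Qed.

(** A u in Ap (e i) that leaves it along e j and along e l would lie below a
    maximal element. *)
Lemma binomial_regular_pair : j != l -> ~ has_maximal S (Ap S (e i)) ->
  regular_seq_in maxid [:: mono (e i); mono (e j) + mono (e l)].
Proof.
move=> jl no_max.
have sub_m : [set` [:: mono (e i); mono (e j) + mono (e l)]] `<=` maxid.
  by move=> f; rewrite /= !inE => /orP[] /eqP ->; [|apply: ideal_genD]; apply: me.
split=> //; split; first exact: monomial_ideal_proper.
have e_inj : e j != e l by rewrite (inj_eq (firsts_inj a_simp)).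
move=> [|[|//]] h _ /=.
- move=> /ideal_gen_nilP fh; apply/ideal_gen_nilP.
  by apply: (semigroup_ring_mulfI (mono_neq0 k (Se i))); rewrite fh mulr0.
apply: (binomial_regular (Se i) (Se j) (Se l)) => // u Su [Nj jP] [Nl lP].
apply: contrapT => iu; apply: no_max.
apply: (lower_set_has_maximal a_simp (u := u)) => //.
- by move=> x [].
- by move=> x s Sx Ss; apply: Ap_lower.
move=> p; have := ijl p; rewrite !inE => /or3P[] /eqP ->.
- by exists 1%N => -[_]; apply; exists u => //; rewrite mulm1n addmC.
- by exists Nj => -[].
- by exists Nl => -[].
Qed.
End Depth.


(** * Dimension three *)

Section DepthDim3.

Lemma third_index (i j : 'I_3) : i != j ->
  exists l, [/\ i != l, j != l & forall p, p \in [:: i; j; l]].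
Proof.
rewrite -val_eqE /= => ij; have [lt_i lt_j] := (ltn_ord i, ltn_ord j).
(* the three indices add up to 3 *)
have lt_l : (3 - i - j < 3)%N by lia.
exists (Ordinal lt_l); rewrite -!val_eqE /=; split; [lia | lia | move=> p].
by have lt_p := ltn_ord p; rewrite !inE -!val_eqE /=; lia.
Qed.

Variables (r : nat) (k : fieldType) (a : 'I_(3 + r) -> 'X_{1..3}).
Hypothesis a_simp : simplicial a.
Local Notation S := (affine_semigroup a).
Local Notation e := (firsts a).
Local Notation maxid := (@monomial_ideal 3 k (3 + r) a).

Lemma regular_triple_cm_criterion s : regular_seq_in maxid s -> (2 < size s)%N ->
  cm_criterion a.
Proof.
case: s => [|f1 [|f2 [|f3 s]]] // [[_ reg] sm] _ i j ij.
have [l [il jl ijl]] := third_index ij.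
apply: (@regular_triple_gap 3 r k a a_simp i j l ijl f1 f2 f3).
- by apply: sm; rewrite /= !inE eqxx.
- by apply: sm; rewrite /= !inE eqxx orbT.
- by apply: sm; rewrite /= !inE eqxx !orbT.
- by move=> h /ideal_gen_nilP f1h; apply/ideal_gen_nilP; apply: (reg 0%N).
- by move=> h; apply: (reg 1%N).
- by move=> h; apply: (reg 2%N).
Qed.

Lemma regular_pair_iff_no_maximal b : S b -> b <> 0%MM ->
  (exists2 s, regular_seq_in maxid s & size s = 2%N) <-> ~ has_maximal S (Ap S b).
Proof.
move=> Sb b0; split=> [[[|f1 [|f2 [|//]]] [[_ reg] sm] //= _]|no_max].
  apply: (@regular_pair_no_maximal 3 k _ a f1 f2) => //.
  - by apply: sm; rewrite /= !inE eqxx.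
  - by apply: sm; rewrite /= !inE eqxx orbT.
  - by move=> h /ideal_gen_nilP f1h; apply/ideal_gen_nilP; apply: (reg 0%N).
  - by move=> h; apply: (reg 1%N).
have [l [il jl ijl]] := @third_index ord0 ord_max isT.
exists [:: mono k a (e ord0); mono k a (e ord_max) + mono k a (e l)] => //.
apply: binomial_regular_pair => //.
by move=> /(has_maximal_Ap_indep Sb b0).
Qed.

Lemma cm_criterionPn : ~ cm_criterion a <->
  exists i j : 'I_3, (i < j)%N /\ has_maximal S (Ap S (e i) `&` Ap S (e j)).
Proof.
have unordered i j : i != j -> has_maximal S (Ap S (e i) `&` Ap S (e j)) ->
  exists i j : 'I_3, (i < j)%N /\ has_maximal S (Ap S (e i) `&` Ap S (e j)).
  rewrite neq_ltn => /orP[ij|ji] maxX; first by exists i, j.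
  by exists j, i; rewrite setIC.
split=> [not_cm|[i [j [ij maxX]]] cm].
  apply: contrapT => no_max; apply: not_cm => i j ij x y Sx Sy xyE.
  apply: contrapT => ix; have [l [il jl ijl]] := third_index ij.
  have [||/(unordered _ _ il)|/(unordered _ _ jl)] //:=
    gap_Ap_cap_has_maximal a_simp il jl ijl ix.
    by exists x; rewrite // addmC.
  by exists y; rewrite // xyE addmC.
have ij' : i != j by rewrite neq_ltn ij.
have [l [il jl _]] := third_index ij'.
exact: (cm_criterion_no_maximal a_simp il jl cm).
Qed.
End DepthDim3.
End DepthOfAffineSemigroupRings.

Theorem theorem5p2 (k : fieldType) (r : nat) (a : 'I_(3 + r) -> 'X_{1..3})
    (a_simplicial : simplicial a) :
  let S_ := affine_semigroup a in
  let Ap_has_no_maximal b := ~ has_maximal S_ (Ap S_ b) in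
  ((exists b, S_ b /\ b <> 0%MM /\ Ap_has_no_maximal b) <->
   (forall b, S_ b -> b <> 0%MM -> Ap_has_no_maximal b)) /\
  (depth_eq (@monomial_ideal 3 k (3 + r) a) 2 <->
   (exists b, S_ b /\ b <> 0%MM /\ Ap_has_no_maximal b) /\
   (exists i j : 'I_3, (i < j)%N /\
      has_maximal S_ (Ap S_ (firsts a i) `&` Ap S_ (firsts a j)))).
Proof.
move=> S_ Ap_has_no_maximal.
have Se0 : S_ (firsts a ord0) by apply: affine_semigroup_firsts.
have e0 := firsts_neq0 a_simplicial (i := ord0).
split.
  split=> [[b [Sb [b0 no_max]]] b' Sb' b'0 maxb'|no_max].
    exact/no_max/(has_maximal_Ap_indep Sb b0 maxb').
  by exists (firsts a ord0); split=> //; split=> //; apply: no_max.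
rewrite -(cm_criterionPn a_simplicial); split.
  move=> [two max_two]; split.
    exists (firsts a ord0); split=> //; split=> //.
    by apply/(regular_pair_iff_no_maximal k a_simplicial Se0 e0).
  move=> cm.
  have [l [il jl ijl]] := @third_index ord0 ord_max isT.
  by have /max_two :=
    @firsts_regular 3 r k a a_simplicial ord0 ord_max l isT il jl cm.
move=> [[b [Sb [b0 no_max]]] not_cm]; split.
  exact/(regular_pair_iff_no_maximal k a_simplicial Sb b0).
move=> s reg_s; rewrite leqNgt; apply/negP => lt_s; apply: not_cm.
exact: regular_triple_cm_criterion reg_s lt_s.
Qed.
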